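(* Let $m\ge 2$. For every permutation $\sigma\in\mathcal S_m\setminus\{12\dots m,\ m\dots 21\}$ there exists $n_0$ such that $$\alpha_n(\sigma)<\alpha_n(12\dots m)\quad\text{for all } n\ge n_0 .$$
   Context: $\mathcal S_n$ is the set of permutations of $\{1,\dots,n\}$ written in one-line notation. For a sequence $\tau=\tau_1\dots\tau_k$ of distinct positive integers, $\operatorname{st}(\tau)\in\mathcal S_k$ is obtained by replacing the smallest entry of $\tau$ by $1$, the second smallest by $2$, and so on. For $\sigma\in\mathcal S_m$ and $\pi\in\mathcal S_n$, an occurrence of $\sigma$ in $\pi$ as a consecutive pattern is a block of adjacent entries with $\operatorname{st}(\pi_i\pi_{i+1}\cdots\pi_{i+m-1})=\sigma$. The permutation $\pi$ avoids $\sigma$ if it has no such occurrence, and $\alpha_n(\sigma)$ is the number of permutations in $\mathcal S_n$ that avoid $\sigma$ as a consecutive pattern. *)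

(* Defs.v *)
From mathcomp Require Import all_boot all_fingroup.
Set Implicit Arguments.
Unset Strict Implicit.
Unset Printing Implicit Defensive.

(* One-line notation, with letters 1, ..., n: the permutation
   s : 'S_n of {0, ..., n-1} stands for the word (s 0 + 1) ... (s (n-1) + 1). *)
Definition one_line (n : nat) (s : 'S_n) : seq nat :=
  [seq (val (s i)).+1 | i <- enum 'I_n].

(* Only meaningful when the entries of t are distinct. *)
Definition st (t : seq nat) : seq nat :=
  [seq (index x (sort leq t)).+1 | x <- t].

Definition occurs_at (m n : nat) (sigma : 'S_m) (p : 'S_n) (i : nat) : bool :=
  (i + m <= n) && (st (take m (drop i (one_line p))) == one_line sigma).

Definition avoids (m n : nat) (sigma : 'S_m) (p : 'S_n) : bool :=
  [forall i : 'I_n.+1, ~~ occurs_at sigma p i].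

Definition alpha (n m : nat) (sigma : 'S_m) : nat :=
  #|[set p : 'S_n | avoids sigma p]|.

Definition incr_perm (m : nat) : 'S_m := 1%g.

Definition decr_perm (m : nat) : 'S_m := perm (@rev_ord_inj m).

(* Main.v *)
Require Import Defs.
From mathcomp Require Import all_boot all_fingroup.
From mathcomp Require Import all_order all_algebra.
From mathcomp Require Import zify ring lra.
Set Implicit Arguments.
Unset Strict Implicit.
Unset Printing Implicit Defensive.
Import Order.TTheory GRing.Theory Num.Theory.

(* Let a_k (resp. b_k) be the probability that a random permutation of size n has
   no occurrence of 12...m (resp. sigma) within its first k entries.  Removing the
   last entry and inclusion-exclusion on the occurrence ending there give
     a_k >= a_(k-1) - a_(k-m)/m! + a_(k-m-1)/(m+1)! - a_(k-2m)/(2m)!,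
     b_k <= b_(k-1) - b_(k-m)/m! + sum_(2 <= j < m) r_j b_(k-m-j)/(m+j)!,
   where r_j is the number of permutations of size m+j covered by two occurrences
   of sigma; r_1 = 0 because sigma is not monotone, and r_j <= C(2j,j)/2.
   For the generating polynomials A and B this yields, coefficientwise,
     A - B >= A B (X^(m+1)/(m+1)! - X^(2m)/(2m)! - sum_j r_j X^(m+j)/(m+j)!),
   and the first term wins since c_k <= x c_(k+1) for the coefficients c_k of A B,
   with x = 4/3 if m = 3 and x = 10/9 if m >= 4.  Hence n0 = m + 1 works. *)

(** * Patterns in windows *)

Lemma card_ord_ltn n c : c <= n -> #|[set y : 'I_n | y < c]| = c.
Proof.
move=> cn; rewrite -sum1_card (eq_bigl (fun y : 'I_n => y < c)); last first.
  by move=> y; rewrite inE.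
by rewrite -(big_ord_widen _ (fun _ => 1) cn) sum1_card card_ord.
Qed.

Lemma perm_rank n (p : 'S_n) (k : 'I_n) : #|[set l | p l < p k]| = p k.
Proof.
have -> : [set l | p l < p k] = p @^-1: [set y : 'I_n | y < p k].
  by apply/setP => l; rewrite !inE.
by rewrite card_preimset ?card_ord_ltn 1?ltnW//; exact: (@perm_inj _ p).
Qed.

(** Each value of a permutation is the number of positions holding smaller values, so the order
    relation determines everything. *)
Lemma order_iso_perm m (s t : 'S_m) :
  (forall k l, (s k < s l) = (t k < t l)) -> s = t.
Proof.
move=> st; apply/permP => k; apply/val_inj; rewrite /= -perm_rank -[RHS]perm_rank.
by congr #|pred_of_set _|; apply/setP => l; rewrite !inE.
Qed.

Lemma pattern_exists L (g : 'I_L -> nat) : injective g ->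
  exists r : 'S_L, forall k l, (g k < g l) = (r k < r l).
Proof.
move=> ginj; pose rk k := #|[set l | g l < g k]|.
have rkL k : rk k < L.
  rewrite -[X in _ < X]card_ord -cardsT; apply: proper_card.
  by apply/properP; split; [exact: subsetT | exists k; rewrite !inE// ltnn].
have rk_lt k l : g k < g l -> rk k < rk l.
  move=> kl; apply: proper_card; apply/properP; split.
    by apply/subsetP => y; rewrite !inE => /ltn_trans; apply.
  by exists k; rewrite !inE// ltnn.
have rkE k l : (g k < g l) = (rk k < rk l).
  apply/idP/idP => [/rk_lt//|]; case: (ltngtP (g k) (g l)) => //.
    by move=> /rk_lt /ltnW; rewrite leqNgt => /negbTE ->.
  by move=> /ginj ->; rewrite ltnn.
have rinj : injective (fun k => Ordinal (rkL k)).
  move=> k l /(congr1 val) /= e; apply: ginj.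
  by case: (ltngtP (g k) (g l)) => // /rk_lt; rewrite e ltnn.
by exists (perm rinj) => k l; rewrite !permE /= rkE.
Qed.

(* The value at [x] is the junk [0] when [n <= x]. *)
Definition letter n (p : 'S_n) (x : nat) : nat :=
  if insub x is Some o then val (p o) else 0.

Lemma letterE n (p : 'S_n) (o : 'I_n) : letter p o = p o.
Proof. by rewrite /letter valK. Qed.

Lemma letter_lt n (p : 'S_n) x (h : x < n) : letter p x = p (Ordinal h).
Proof. by rewrite -letterE. Qed.

Lemma letter_inj n (p : 'S_n) x y : x < n -> y < n -> letter p x = letter p y -> x = y.
Proof.
by move=> hx hy; rewrite !letter_lt => /val_inj/perm_inj/(congr1 val).
Qed.

(** Phrased as order isomorphism, and for an arbitrary [g] on [nat], so that positions need no bound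
    proofs and one predicate serves permutations of different sizes. *)
Definition occ m (s : 'S_m) (g : nat -> nat) (i : nat) : bool :=
  [forall k : 'I_m, forall l : 'I_m, (g (i + k) < g (i + l)) == (s k < s l)].

Lemma occP m (s : 'S_m) g i :
  reflect (forall k l : 'I_m, (g (i + k) < g (i + l)) = (s k < s l)) (occ s g i).
Proof.
apply: (iffP forallP) => h k; first by move=> l; move/forallP: (h k) => /(_ l)/eqP.
by apply/forallP => l; rewrite h.
Qed.

Lemma occ_letterP m (s : 'S_m) g i :
  reflect (forall k l : nat, k < m -> l < m ->
             (g (i + k) < g (i + l)) = (letter s k < letter s l)) (occ s g i).
Proof.
apply: (iffP (occP s g i)) => h k l => [hk hl|].
  by rewrite !letter_lt -h.
by rewrite h ?ltn_ord// !letterE.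
Qed.

Lemma eq_in_occ m (s : 'S_m) g h i :
  (forall k, k < m -> g (i + k) = h (i + k)) -> occ s g i = occ s h i.
Proof.
move=> gh; apply/eq_forallb => k; apply/eq_forallb => l.
by rewrite !gh.
Qed.

Lemma occ_uniq L (r r' : 'S_L) g i : occ r g i -> occ r' g i -> r = r'.
Proof.
move=> /occP h /occP h'; apply: order_iso_perm => k l.
by rewrite -h -h'.
Qed.

Lemma occ_exists n (p : 'S_n) i L : i + L <= n ->
  exists r : 'S_L, occ r (letter p) i.
Proof.
move=> iL; have [|r rP] := @pattern_exists L (fun k => letter p (i + k)).
  move=> k l /letter_inj e; apply/val_inj/(@addnI i)/e.
    by rewrite (leq_trans _ iL)// ltn_add2l.
  by rewrite (leq_trans _ iL)// ltn_add2l.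
by exists r; apply/occP => k l; rewrite rP.
Qed.

(** In [s * p] the factor [s] acts first, hence moves positions: it is taken to be [t] on the window
    and the identity elsewhere. *)
Lemma window_perm n i L (t : 'S_L) : i + L <= n ->
  exists s : 'S_n, (forall x : 'I_n, x < i -> s x = x) /\
    forall (p : 'S_n) (k : 'I_L), letter (s * p)%g (i + k) = letter p (i + t k).
Proof.
move=> iL; have wP (k : 'I_L) : i + k < n by rewrite (leq_trans _ iL)// ltn_add2l.
pose w k := Ordinal (wP k).
have winj : injective w by move=> k l /(congr1 val)/= /addnI/val_inj.
pose e (u : 'S_L) x := if [pick k | w k == x] is Some k then w (u k) else x.
have ew u k : e u (w k) = w (u k).
  rewrite /e; case: pickP => [l /eqP/winj-> //|/(_ k)]; by rewrite eqxx.
have eN u x : (forall k, w k != x) -> e u x = x.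
  by move=> h; rewrite /e; case: pickP => // k; rewrite (negbTE (h k)).
have einj : injective (e t).
  apply: (can_inj (g := e t^-1%g)) => x.
  case: (pickP (fun k => w k == x)) => [k /eqP <-|h]; first by rewrite !ew permK.
  by rewrite !eN// => k; rewrite h.
exists (perm einj); split=> [x xi|p k].
  rewrite permE eN// => k; apply/eqP => /(congr1 val) /= e1.
  by move: xi; rewrite -e1 ltnNge leq_addr.
by rewrite (letter_lt _ (wP k)) (letter_lt _ (wP (t k))) permM permE ew.
Qed.

(** Invariance under rearranging the positions from [i] on expresses that [Q] depends only on the
    first [i] letters. *)
Definition prefix_event n i (Q : pred 'S_n) : Prop :=
  forall p s : 'S_n, (forall x : 'I_n, x < i -> s x = x) -> Q (s * p)%g = Q p.

(* Permuting the positions of the window preserves [Q] and carries any pattern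
   of the window to any other, so all L! patterns are equally likely given [Q]. *)
Lemma card_window n i L (r : 'S_L) (Q : pred 'S_n) :
  i + L <= n -> prefix_event i Q ->
  #|[set p | Q p && occ r (letter p) i]| * L`! = #|[set p | Q p]|.
Proof.
move=> iL QP.
have leN (r1 r2 : 'S_L) : #|[set p | Q p && occ r1 (letter p) i]|
                       <= #|[set p | Q p && occ r2 (letter p) i]|.
  (* If the window of [p] has pattern [r1], then the letter at [k] in the rearranged window has rank
     [r1 (r1^-1 (r2 k)) = r2 k]. *)
  have [s [s1 s2]] := @window_perm n i L (r2 * r1^-1)%g iL.
  rewrite -(card_imset _ (@mulgI _ s)); apply: subset_leq_card.
  apply/subsetP => _ /imsetP[p + ->]; rewrite !inE => /andP[Qp /occP o].
  rewrite QP// Qp; apply/occP => k l.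
  by rewrite !s2 o !permM !permKV.
have eqN (r1 : 'S_L) : #|[set p | Q p && occ r1 (letter p) i]|
            = #|[set p | Q p && occ r (letter p) i]|.
  by apply/eqP; rewrite eqn_leq; apply/andP; split; exact: leN.
(* Sum the equal counts over all [L!] patterns and exchange the sums: each [p] shows exactly one
   pattern in the window. *)
rewrite mulnC -card_Sn -sum_nat_const.
rewrite (eq_bigr (fun r1 : 'S_L => #|[set p | Q p && occ r1 (letter p) i]|)); last first.
  by move=> r1 _; rewrite eqN.
rewrite (eq_bigl predT); last by move=> x; rewrite inE.
under eq_bigr do rewrite -sum1_card big_mkcond.
rewrite exchange_big -sum1_card [RHS]big_mkcond /=; apply: eq_bigr => p _.
rewrite inE; case: (boolP (Q p)) => Qp; last first.
  by rewrite big1// => r1 _; rewrite inE (negbTE Qp).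
have [r0 r0P] := occ_exists p iL.
rewrite (bigD1 r0)//= big1 ?inE ?Qp ?r0P// => r1 ne; rewrite inE Qp /=.
by case: ifP => // /(occ_uniq r0P) e; rewrite e eqxx in ne.
Qed.

(** * From standardization of one-line notation to order isomorphism *)

Lemma index_sort_count (t : seq nat) x : uniq t -> x \in t ->
  index x (sort leq t) = count (fun y => y < x) t.
Proof.
move=> ut xt; set s := sort leq t.
have ss : sorted Order.lt s by rewrite Order.TotalTheory.sort_lt_sorted.
have xs : x \in s by rewrite mem_sort.
have := @Order.PreorderTheory.count_lt_nth _ _ 0 s (index x s) ss.
rewrite index_mem nth_index// => /(_ xs) <-.
have /seq.permP -> // : perm_eq s t by rewrite perm_sort.
Qed.

Lemma nth_one_line n (p : 'S_n) (x : nat) : x < n ->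
  nth 0 (one_line p) x = (letter p x).+1.
Proof.
move=> xn; rewrite (letter_lt p xn) /one_line.
rewrite (nth_map (Ordinal xn)) ?size_enum_ord//.
by congr (val (p _)).+1; apply/val_inj; rewrite /= nth_enum_ord.
Qed.

Lemma size_one_line n (p : 'S_n) : size (one_line p) = n.
Proof. by rewrite size_map size_enum_ord. Qed.

Lemma letter_prefix n (p s : 'S_n) i x : (forall x : 'I_n, x < i -> s x = x) ->
  x < i -> letter (s * p)%g x = letter p x.
Proof.
move=> sP xi; have [xn|nx] := ltnP x n.
  by rewrite !(letter_lt _ xn) permM sP.
by rewrite /letter insubF// ltnNge nx.
Qed.

(** The bound [x.+1] absorbs the shift between [one_line], with letters from 1, and [letter], with
    values from 0. *)
Lemma count_window n (p : 'S_n) i m x : i + m <= n ->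
  count (fun y => y < x.+1) (take m (drop i (one_line p)))
  = #|[set l : 'I_m | letter p (i + l) < x]|.
Proof.
move=> im; have sz : size (take m (drop i (one_line p))) = m.
  by rewrite size_takel// size_drop size_one_line; lia.
rewrite -[take _ _](mkseq_nth 0) sz /mkseq count_map -val_enum_ord count_map.
rewrite cardE [in RHS]/enum_mem size_filter -enumT; apply: eq_count => l /=.
rewrite inE nth_take// nth_drop nth_one_line//.
by rewrite (leq_trans _ im)// ltn_add2l.
Qed.

(** The entry of [st] at [k] is one plus the rank of the [k]-th letter within the window; ranks and
    order relation determine each other. *)
Lemma occurs_atE m n (s : 'S_m) (p : 'S_n) i :
  occurs_at s p i = (i + m <= n) && occ s (letter p) i.
Proof.
rewrite /occurs_at; case: (leqP (i + m) n) => //= im.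
set t := take _ _.
have sz : size t = m by rewrite size_takel// size_drop size_one_line; lia.
have in_n (k : nat) : k < m -> i + k < n by lia.
have tE k : k < m -> nth 0 t k = (letter p (i + k)).+1.
  by move=> km; rewrite nth_take// nth_drop nth_one_line// in_n.
have ut : uniq t.
  apply/(uniqP 0) => k l; rewrite !inE sz => km lm.
  rewrite !tE// => -[] /letter_inj e; apply/(@addnI i)/e; exact: in_n.
have stE (k : 'I_m) : nth 0 (st t) k =
    #|[set l : 'I_m | letter p (i + l) < letter p (i + k)]|.+1.
  rewrite (nth_map 0) ?sz// index_sort_count ?mem_nth ?sz//.
  by rewrite tE// count_window.
apply/eqP/occP => [e k l|h].
  have rkE (k' : 'I_m) : #|[set l' : 'I_m | letter p (i + l') < letter p (i + k')]| = s k'.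
    by apply: succn_inj; rewrite -stE e nth_one_line// letterE.
  have lt_rk (k' l' : 'I_m) : letter p (i + k') < letter p (i + l') -> s k' < s l'.
    move=> kl; rewrite -!rkE; apply: proper_card; apply/properP; split.
      by apply/subsetP => y; rewrite !inE => /ltn_trans; apply.
    by exists k'; rewrite !inE// ltnn.
  apply/idP/idP => [/lt_rk//|].
  case: (ltngtP (letter p (i + k)) (letter p (i + l))) => //.
    by move=> /lt_rk /ltnW; rewrite leqNgt => /negbTE ->.
  move=> /letter_inj e'; have /addnI/val_inj -> : i + k = i + l by apply: e'; exact: in_n.
  by rewrite ltnn.
apply: (@eq_from_nth _ 0); rewrite ?size_one_line ?size_map ?sz// => k km.
rewrite nth_one_line// -[k]/(val (Ordinal km)) stE letterE -perm_rank.
by congr #|pred_of_set _|.+1; apply/setP => l; rewrite !inE h.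
Qed.

(** Avoidance is restricted to the first [k] letters of a permutation of fixed size [n], so that all
    lengths [k] are compared inside one probability space. *)
Definition prefix_avoids m (s : 'S_m) n k (p : 'S_n) : bool :=
  [forall i : 'I_k.+1, (i + m <= k) ==> ~~ occ s (letter p) i].

Lemma prefix_avoidsP m (s : 'S_m) n k (p : 'S_n) :
  reflect (forall i, i + m <= k -> ~~ occ s (letter p) i) (prefix_avoids s k p).
Proof.
apply: (iffP forallP) => h i => [ik|]; last by apply/implyP/h.
have ik' : i < k.+1 by lia.
by have /implyP/(_ ik) := h (Ordinal ik').
Qed.

Lemma avoids_prefix_avoids m (s : 'S_m) n (p : 'S_n) : avoids s p = prefix_avoids s n p.
Proof.
apply/forallP/prefix_avoidsP => h i => [im|]; last first.
  by rewrite occurs_atE; case: leqP => //= /h.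
have ik' : i < n.+1 by lia.
by have := h (Ordinal ik'); rewrite occurs_atE /= im.
Qed.

Lemma prefix_avoids_leq m (s : 'S_m) n k l (p : 'S_n) : 
  k <= l -> prefix_avoids s l p -> prefix_avoids s k p.
Proof. by move=> kl /prefix_avoidsP h; apply/prefix_avoidsP => i ik; apply: h; lia. Qed.

Lemma prefix_avoidsS m (s : 'S_m) n i (p : 'S_n) : 0 < m ->
  prefix_avoids s (i + m) p = prefix_avoids s (i + m).-1 p && ~~ occ s (letter p) i.
Proof.
move=> m0; apply/prefix_avoidsP/andP => [h|[/prefix_avoidsP h1 h2] j ji].
  by split; [apply/prefix_avoidsP => j ji; apply: h; lia | apply: h].
have [->//|ne] := eqVneq j i; apply: h1; lia.
Qed.

Lemma prefix_avoids_event m (s : 'S_m) n k : @prefix_event n k (prefix_avoids s k).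
Proof.
move=> p u uP; apply/eq_forallb => i; case: leqP => //= ik.
by rewrite (@eq_in_occ _ _ _ (letter p))// => l lm; rewrite (letter_prefix _ uP)//; lia.
Qed.

(** * Monotone patterns *)

Lemma occ_incrP m g i :
  reflect (forall k, k.+1 < m -> g (i + k) < g (i + k.+1)) (occ (incr_perm m) g i).
Proof.
apply: (iffP (occP _ _ _)) => [h k km|h k l].
  by have := h (Ordinal (ltnW km)) (Ordinal km); rewrite !perm1 /= => ->.
rewrite !perm1.
have lt (k' l' : nat) : k' < l' -> l' < m -> g (i + k') < g (i + l').
  elim: l' => // l' IH; rewrite ltnS leq_eqVlt => /orP[/eqP ->|kl] lm; first exact: h.
  by apply: ltn_trans (IH kl _) (h _ lm); lia.
case: (ltngtP k l) => [kl|lk|->]; first by rewrite lt.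
  by rewrite ltnNge ltnW// lt.
by rewrite ltnn.
Qed.

Lemma const_steps_monotone m (s : 'S_m) b :
  (forall k, k.+1 < m -> (letter s k < letter s k.+1) = b) ->
  s = incr_perm m \/ s = decr_perm m.
Proof.
case: b => h; [left|right]; apply: order_iso_perm => k l; last first.
  have lt (k' l' : nat) : k' < l' -> l' < m -> letter s l' < letter s k'.
    have step k0 : k0.+1 < m -> letter s k0.+1 < letter s k0.
      move=> km; have := h _ km; case: ltngtP => // /letter_inj e _.
      by have := e (ltnW km) km; lia.
    elim: l' => // l' IH; rewrite ltnS leq_eqVlt => /orP[/eqP ->|kl] lm; first exact: step.
    by apply: ltn_trans (step _ lm) (IH kl _); lia.
  rewrite !permE /= -!letterE; have := ltn_ord k; have := ltn_ord l.
  case: (ltngtP k l) => [kl|lk|->]; rewrite ?ltnn//.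
    have := lt _ _ kl (ltn_ord l); lia.
  have := lt _ _ lk (ltn_ord k); lia.
have /occ_incrP : forall k0, k0.+1 < m -> letter s (0 + k0) < letter s (0 + k0.+1).
  by move=> k0 /h ->.
by move=> /occP /(_ k l) <-; rewrite !add0n !letterE.
Qed.

(** Reading the same letters through both windows equates the comparison of [s] at [k], [k+1] with
    the one at [k+1], [k+2]; so all adjacent comparisons agree. *)
Lemma occ_succ_monotone m (s : 'S_m) g i :
  occ s g i -> occ s g i.+1 -> s = incr_perm m \/ s = decr_perm m.
Proof.
move=> /occ_letterP h /occ_letterP h'.
apply: (@const_steps_monotone _ _ (letter s 0 < letter s 1)); elim=> // k IH km.
rewrite -IH ?(ltnW km)// -h ?(ltnW km)// -h' ?(ltnW (ltnW km))//; last by lia.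
by rewrite !addSn !addnS.
Qed.

(** For [m <= 2] there is at most one adjacent comparison, so the comparisons are trivially
    constant. *)
Lemma nonmonotone_size m (s : 'S_m) :
  s <> incr_perm m -> s <> decr_perm m -> 2 < m.
Proof.
move=> h1 h2; rewrite ltnNge; apply/negP => m2.
have [] // := @const_steps_monotone _ s (letter s 0 < letter s 1).
by move=> k km; have -> : k = 0 by lia.
Qed.

(** * Counting inequalities by inclusion and exclusion *)

Section Counting.
Variables (n : nat).
Local Notation N P := #|[set p : 'S_n | P p]|.

Lemma card_set_sum (P : pred 'S_n) : N P = \sum_(p : 'S_n) P p.
Proof.
rewrite -sum1_card big_mkcond /=; apply: eq_bigr => p _.
by rewrite inE; case: (P p).
Qed.

(** Holds for each [p] separately. If the first [i + m - 1] letters avoid [s], the left side is 1.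
    Otherwise a contribution on the left needs an occurrence at [i] and none within the first [i]
    letters, so an earlier one starts at some [i - j] with [1 <= j < m], and the sum counts it. *)
Lemma prefix_avoids_step_le m (s : 'S_m) i : 0 < m ->
  N (prefix_avoids s (i + m)) + N (fun p => prefix_avoids s i p && occ s (letter p) i) <=
  N (prefix_avoids s (i + m).-1) + \sum_(1 <= j < m | j <= i)
     N (fun p => prefix_avoids s (i - j) p &&
                 (occ s (letter p) (i - j) && occ s (letter p) i)).
Proof.
move=> m0; rewrite !card_set_sum; under [X in _ <= _ + X]eq_bigr do rewrite card_set_sum.
rewrite exchange_big -!big_split /=; apply: leq_sum => p _.
rewrite prefix_avoidsS//; case: (boolP (prefix_avoids s (i + m).-1 p)) => h.
  by rewrite (prefix_avoids_leq _ h) ?andTb; [case: (occ _ _ _); lia | lia].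
case: (boolP (prefix_avoids s i p && _)) => // /andP[ai oi].
have [j ij nj] : exists2 j, j + m <= (i + m).-1 & occ s (letter p) j.
  move: h; rewrite negb_forall => /existsP[j]; rewrite negb_imply negbK.
  by move=> /andP[]; exists j.
have ji : i < j + m.
  by rewrite ltnNge; apply/negP => jm; move/prefix_avoidsP: ai => /(_ _ jm); rewrite nj.
have ijj : i - (i - j) = j by lia.
rewrite (big_cat_nat (n := i - j)) /=; [|lia|lia].
rewrite [X in _ <= _ + (_ + X)]big_ltn_cond; last by lia.
rewrite leq_subr ijj nj oi (prefix_avoids_leq _ ai); [|lia]; lia.
Qed.

(** Again for each [p]. An increasing run of length [m + 1] from [i - 1] contains the occurrence at
    [i], counted on the right unless the first [i] letters already contain one. That one must end at
    position [i - 1], and then both runs join to a run of length [2m] from [i - m]. The boolean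
    factors guard the truncated subtractions. *)
Lemma incr_step_ge m i : 1 < m ->
  N (prefix_avoids (incr_perm m) (i + m).-1) +
    (0 < i) * N (fun p => prefix_avoids (incr_perm m) i.-1 p &&
                          occ (incr_perm m.+1) (letter p) i.-1)
  <= N (prefix_avoids (incr_perm m) (i + m)) +
     N (fun p => prefix_avoids (incr_perm m) i p && occ (incr_perm m) (letter p) i) +
     (m <= i) * N (fun p => prefix_avoids (incr_perm m) (i - m) p
                         && occ (incr_perm (m + m)) (letter p) (i - m)).
Proof.
move=> m1; rewrite !card_set_sum !big_distrr -!big_split /=; apply: leq_sum => p _.
rewrite (prefix_avoidsS _ _ _ (ltnW m1)); set s := incr_perm m; set g := letter p.
have [->|i0] := posnP i.
  rewrite mul0n addn0; case: (boolP (prefix_avoids s _ p)) => //= h.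
  have -> : prefix_avoids s 0 p by apply: prefix_avoids_leq h; lia.
  by case: occ.
rewrite mul1n; case: (boolP (prefix_avoids s (i + m).-1 p)) => h.
  have -> : prefix_avoids s i p by apply: prefix_avoids_leq h; lia.
  have -> : occ (incr_perm m.+1) g i.-1 = false.
    apply/negbTE/negP => /occ_incrP o; move/prefix_avoidsP: h => /(_ i.-1).
    have -> : i.-1 + m <= (i + m).-1 by lia.
    move=> /(_ isT)/negP; apply; apply/occ_incrP => k km; apply: o; lia.
  case: (occ s g i) => /=; lia.
rewrite !add0n; case: (boolP (_ && _)) => // /andP[ai /occ_incrP o].
have oi : occ s g i.
  apply/occ_incrP => k km; have := o k.+1 km.
  have -> : i.-1 + k.+1 = i + k by lia.
  by have -> : i.-1 + k.+2 = i + k.+1 by lia.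
rewrite oi andbT /=; case: (boolP (prefix_avoids s i p)) => // nai.
have [j jm oj] : exists2 j, j + m <= i & occ s g j.
  move: nai; rewrite negb_forall => /existsP[j]; rewrite negb_imply negbK.
  by move=> /andP[]; exists j.
have ji : i.-1 < j + m.
  by rewrite ltnNge; apply/negP => jm'; move/prefix_avoidsP: ai => /(_ _ jm'); rewrite oj.
have jE : i - m = j by lia.
have -> : prefix_avoids s (i - m) p by apply: prefix_avoids_leq ai; lia.
rewrite jE; have -> : m <= i by lia.
rewrite mul1n andTb; suff -> : occ (incr_perm (m + m)) g j by [].
apply/occ_incrP => k km; case: (ltnP k.+1 m) => [|mk].
  by move=> km'; move/occ_incrP: oj; apply.
have := o (j + k - i.-1).
have -> : i.-1 + (j + k - i.-1) = j + k by lia.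
have -> : i.-1 + (j + k - i.-1).+1 = j + k.+1 by lia.
by apply; lia.
Qed.

End Counting.

(** * Clusters of two occurrences *)

Definition window L i m : {set 'I_L} := [set y : 'I_L | i <= y < i + m].

Lemma window_rank L m (s : 'S_m) (r : 'S_L) i (x : 'I_L) : i + m <= L ->
  occ s (letter r) i -> x \in window L i m ->
  #|[set v in r @: window L i m | v < r x]| = letter s (x - i).
Proof.
rewrite inE => iL /occP o /andP[ix xi].
have wP (l : 'I_m) : i + l < L by rewrite (leq_trans _ iL)// ltn_add2l.
have km : x - i < m by lia.
pose f l := r (Ordinal (wP l)).
have finj : injective f.
  by move=> l l' /perm_inj/(congr1 val)/= /addnI/val_inj.
rewrite (letter_lt _ km) -[RHS]perm_rank -[RHS](card_imset _ finj).
have rE l : r (Ordinal (wP l)) = letter r (i + l) :> nat by rewrite -letterE.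
have xE : r x = letter r (i + Ordinal km) :> nat.
  by rewrite -letterE /=; congr letter; lia.
congr #|pred_of_set _|; apply/setP => v; rewrite !inE.
apply/andP/imsetP => [[/imsetP[y]]|[l]].
  rewrite inE => /andP[iy yi] -> lt; have ym : y - i < m by lia.
  have yE : y = Ordinal (wP (Ordinal ym)) by apply/val_inj => /=; lia.
  exists (Ordinal ym); last by rewrite /f -yE.
  by rewrite inE -o -rE -xE -yE.
rewrite inE -o => lt ->; split; last by rewrite rE xE.
by apply: imset_f; rewrite inE /= leq_addr ltn_add2l /=.
Qed.

(** In the common set of values, the value at [x] is the one whose rank is prescribed by [s]. *)
Lemma window_eq L m (s : 'S_m) (r r' : 'S_L) i : i + m <= L ->
  occ s (letter r) i -> occ s (letter r') i ->
  r @: window L i m = r' @: window L i m ->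
  {in window L i m, r =1 r'}.
Proof.
move=> iL o o' e x xw.
wlog lt : r r' o o' e / r x < r' x.
  move=> H; case: (ltngtP (r x) (r' x)) => [lt|lt|/val_inj//].
    exact: H lt.
  by apply/esym/(H r' r).
have := window_rank iL o xw; rewrite -(window_rank iL o' xw) e => /eqP.
rewrite ltn_eqF//; apply: proper_card; apply/properP; split.
  by apply/subsetP => v; rewrite !inE => /andP[-> /ltn_trans]; apply.
by exists (r x); rewrite !inE ?ltnn ?andbF// lt andbT -e imset_f.
Qed.

Definition clusters m (s : 'S_m) j : {set 'S_(m + j)} :=
  [set r | occ s (letter r) 0 && occ s (letter r) j].

Section Clusters.
Variables (m : nat) (s : 'S_m) (j : nat).
Hypotheses (j0 : 0 < j) (jm : j < m).
Let L := m + j.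
Let fst_part (r : 'S_L) := r @: window L 0 j.
Let mid_part (r : 'S_L) := r @: window L j (m - j).
Let lst_part (r : 'S_L) := r @: window L m j.

Let imsetWU (r : 'S_L) a b c : r @: window L a b :|: r @: window L (a + b) c
  = r @: window L a (b + c).
Proof.
rewrite -imsetU; congr (r @: pred_of_set _); apply/setP => y; rewrite !inE; lia.
Qed.

Let disjW (r : 'S_L) a b c d : a + b <= c ->
  [disjoint r @: window L a b & r @: window L c d].
Proof.
move=> abc; rewrite imset_disjoint ?disjoint_subset; last exact: perm_inj.
by apply/subsetP => y; rewrite !inE; lia.
Qed.

Let card_ltU (A B : {set 'I_L}) (v : 'I_L) : [disjoint A & B] ->
  #|[set u in A :|: B | u < v]| = #|[set u in A | u < v]| + #|[set u in B | u < v]|.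
Proof.
move=> AB; rewrite -cardsUI [X in _ = _ + X](_ : _ = 0) ?addn0.
  by congr #|pred_of_set _|; apply/setP => u; rewrite !inE andb_orl.
apply/eqP; rewrite cards_eq0 -subset0; apply/subsetP => u; rewrite !inE.
case: (boolP (u \in A)) => //= uA; case: (boolP (u \in B)); last by rewrite andbF.
by rewrite (disjointFr AB uA).
Qed.

Let fst_window (r : 'S_L) : fst_part r :|: mid_part r = r @: window L 0 m.
Proof. by rewrite /fst_part /mid_part imsetWU subnKC// ltnW. Qed.

Let lst_window (r : 'S_L) : mid_part r :|: lst_part r = r @: window L j m.
Proof.
have jmE : j + (m - j) = m by rewrite subnKC// ltnW.
by rewrite /lst_part /mid_part -[X in window _ X j]jmE imsetWU subnK// ltnW.
Qed.

(** For [x] in the overlap, [s x] and [s (x - j)] count the values below [q x] in the first and in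
    the second window. Their sum is [q x] plus the number of smaller values in the overlap, and that
    number depends on [s] only. *)
Let cluster_mid (r r' : 'S_L) : r \in clusters s j -> r' \in clusters s j ->
  {in window L j (m - j), r =1 r'}.
Proof.
suff rE (q : 'S_L) (x : 'I_L) : q \in clusters s j -> x \in window L j (m - j) ->
    q x + #|[set y : 'I_L | (y \in window L j (m - j)) && (letter s y < letter s x)]|
      = letter s x + letter s (x - j).
  move=> rC r'C x xw; apply/val_inj/(@addIn
    #|[set y : 'I_L | (y \in window L j (m - j)) && (letter s y < letter s x)]|).
  by rewrite /= !rE.
rewrite inE => /andP[o0 oj] xw.
have xw0 : x \in window L 0 m by move: xw; rewrite !inE; lia.
have xwj : x \in window L j m by move: xw; rewrite !inE; lia.
have -> : #|[set y : 'I_L | (y \in window L j (m - j)) && (letter s y < letter s x)]|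
    = #|[set u in mid_part q | u < q x]|.
  rewrite -[LHS](card_imset _ (@perm_inj _ q)); congr #|pred_of_set _|.
  apply/setP => v; rewrite !inE; apply/imsetP/andP => [[y]|[]].
    rewrite inE => /andP[yw lt] ->; split; first exact: imset_f.
    move/occ_letterP: o0 => /(_ y x); rewrite !add0n !letterE => ->//.
      by move: yw; rewrite inE; lia.
    by move: xw; rewrite inE; lia.
  move=> /imsetP[y yw ->] lt; exists y => //; rewrite inE yw /=.
  move/occ_letterP: o0 => /(_ y x); rewrite !add0n !letterE => <-//.
    by move: yw; rewrite inE; lia.
  by move: xw; rewrite inE; lia.
have := window_rank (leq_addr _ _) o0 xw0; rewrite subn0 => <-.
have -> : letter s (x - j) = #|[set v in q @: window L j m | v < q x]|.
  by rewrite (window_rank _ oj xwj)// addnC.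
rewrite -fst_window -lst_window !card_ltU; [|exact: disjW|apply: disjW; lia].
rewrite -[X in X + _ = _](perm_rank q x).
have -> : #|[set l | q l < q x]| =
    #|[set v in (fst_part q :|: mid_part q) :|: lst_part q | v < q x]|.
  rewrite -[LHS](card_imset _ (@perm_inj _ q)); congr #|pred_of_set _|.
  rewrite fst_window /lst_part -[X in window _ X j]add0n imsetWU.
  apply/setP => v; rewrite !inE; apply/imsetP/andP => [[l]|[]].
    by rewrite inE => lt ->; split=> //; apply: imset_f; rewrite inE /=.
  by move=> /imsetP[l _ ->] lt; exists l; rewrite ?inE.
rewrite !card_ltU; [by rewrite -!addnA; do 2 congr (_ + _); exact: addnC|exact: disjW|].
by rewrite fst_window; apply: disjW.
Qed.

Let card_imset_window (r : 'S_L) a b : a + b <= L -> #|r @: window L a b| = b.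
Proof.
move=> ab; rewrite (card_imset _ (@perm_inj _ r)).
rewrite -[RHS](card_ord b) -[RHS]cardsT.
have wP (l : 'I_b) : a + l < L by rewrite (leq_trans _ ab)// ltn_add2l.
rewrite -(@card_imset _ _ (fun l : 'I_b => Ordinal (wP l))); last first.
  by move=> l l' /(congr1 val)/= /addnI/val_inj.
congr #|pred_of_set _|; apply/setP => y; rewrite inE.
apply/andP/imsetP => [[ay ya]|[l _ ->]]; last by rewrite /= leq_addr ltn_add2l.
have yb : y - a < b by lia.
by exists (Ordinal yb) => //; apply/val_inj => /=; lia.
Qed.

(* The values in the middle positions are the same for all clusters, so a cluster
   is determined by the j-set of its first j values, and also by the j-set of its
   last j values, both inside a fixed 2j-set.  No j-set arises in both ways: the
   value at position j would have rank [s j] in the first window of one cluster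
   and rank [s 0] in the second window of the other, with equal ranks. *)
Lemma card_clusters : 2 * #|clusters s j| <= 'C(2 * j, j).
Proof.
have [->|[r0 r0C]] := set_0Vmem (clusters s j); first by rewrite cards0.
set C := clusters s j in r0C *.
have midE r : r \in C -> mid_part r = mid_part r0.
  by move=> rC; apply: eq_in_imset => x xw; apply: cluster_mid.
have lstE r : lst_part r = ~: (fst_part r :|: mid_part r).
  have all : (fst_part r :|: mid_part r) :|: lst_part r = setT.
    rewrite fst_window /lst_part -[X in window _ X j]add0n imsetWU.
    apply/setP => v; rewrite !inE -[v](permKV r); apply: imset_f.
    by rewrite inE /=.
  have dis : [disjoint fst_part r :|: mid_part r & lst_part r].
    by rewrite fst_window; apply: disjW.
  apply/setP => v; rewrite in_setC; have := in_setT v; rewrite -all in_setU.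
  by case: (boolP (v \in fst_part r :|: mid_part r)) => //= vA _; rewrite (disjointFr dis vA).
(* The first and middle values fill the first window; the complement gives the last values, hence
   the value set of the second window, and [window_eq] applies to both. *)
have fst_inj : {in C &, injective fst_part}.
  move=> r r' rC r'C e; apply/permP => x.
  have := rC; have := r'C; rewrite !inE => /andP[o0' oj'] /andP[o0 oj].
  have [xm|mx] := ltnP x m.
    apply: (window_eq _ o0 o0'); rewrite ?leq_addr ?inE//.
    by rewrite -!fst_window e midE// (midE r').
  have jmL : j + m <= L by rewrite addnC.
  apply: (window_eq jmL oj oj').
    by rewrite -!lst_window !lstE e midE// (midE r').
  by rewrite inE [j + m]addnC ltn_ord andbT (leq_trans (ltnW jm)).
have lst_inj : {in C &, injective lst_part}.
  move=> r r' rC r'C e; apply: fst_inj => //.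
  have fE q : fst_part q = ~: (lst_part q :|: mid_part q).
    have dis : [disjoint fst_part q & mid_part q] by apply: disjW.
    rewrite lstE; apply/setP => v; rewrite !inE negb_or negbK andb_orl andbN orbF.
    by case: (boolP (v \in fst_part q)) => //= /(disjointFr dis) ->.
  by rewrite !fE e midE// (midE r').
have dis : [disjoint fst_part @: C & lst_part @: C].
  apply/pred0P => A /=; apply/negbTE/negP => /andP[/imsetP[r rC ->] /imsetP[r' r'C e]].
  have jmE : j + (m - j) = m by rewrite subnKC// ltnW.
  have jL : j < L by rewrite (leq_trans jm)// leq_addr.
  have m0 : 0 < m by apply: leq_ltn_trans jm.
  pose x := Ordinal jL.
  have xw : x \in window L j (m - j) by rewrite inE jmE /= leqnn.
  have := rC; have := r'C; rewrite !inE => /andP[o0' oj'] /andP[o0 oj].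
  have xw0 : x \in window L 0 m by rewrite inE.
  have jmL : j + m <= L by rewrite addnC.
  have xwj : x \in window L j m by rewrite inE /= leqnn -ltn_subLR// subnn.
  have := window_rank (leq_addr _ _) o0 xw0.
  have := window_rank jmL oj' xwj; rewrite -fst_window -lst_window.
  rewrite !card_ltU; [|exact: disjW|by apply: disjW; rewrite jmE].
  rewrite (cluster_mid rC r'C xw) e (midE r')// (midE r)// addnC => -> /= /esym.
  by rewrite subn0 subnn => /letter_inj e0; move: j0; rewrite e0.
have le : fst_part @: C :|: lst_part @: C \subset
    [set A : {set 'I_L} | A \subset ~: mid_part r0 & #|A| == j].
  apply/subsetP => A; rewrite !inE => /orP[] /imsetP[r rC ->].
    rewrite -(midE _ rC) card_imset_window ?eqxx ?andbT; last by rewrite /L; lia.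
    by rewrite -disjoints_subset; apply: disjW.
  rewrite -(midE _ rC) card_imset_window ?eqxx ?andbT//.
  by rewrite -disjoints_subset disjoint_sym; apply: disjW; lia.
have := subset_leq_card le; rewrite cards_draws cardsU.
rewrite (eqP (_ : fst_part @: C :&: lst_part @: C == set0)) ?setI_eq0// cards0 subn0.
rewrite !card_in_imset// addnn -mul2n => /leq_trans; apply.
suff -> : #|~: mid_part r0| = 2 * j by [].
rewrite cardsCs setCK card_ord.
rewrite /mid_part card_imset_window /L; lia.
Qed.
End Clusters.

(** * Renewal inequalities *)

Section Renewal.
Local Open Scope ring_scope.

Lemma le_coef_mulr (K : realFieldType) (p q r : {poly K}) n :
  (forall k, 0 <= p`_k) -> (forall k, (k <= n)%N -> q`_k <= r`_k) ->
  (p * q)`_n <= (p * r)`_n.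
Proof.
move=> p0 qr; rewrite !coefM; apply: ler_sum => i _.
by apply: ler_wpM2l => //; apply: qr; rewrite leq_subr.
Qed.

Lemma coefMDX (K : realFieldType) (p : {poly K}) u m k :
  (p * (1 - 'X + u *: 'X^m))`_k.+1
  = p`_k.+1 - p`_k + (if (k.+1 < m)%N then 0 else u * p`_(k.+1 - m)).
Proof.
rewrite mulrDr mulrBr mulr1 coefD coefB coefMX /= -scalerAr coefZ coefMXn.
by case: ifP; rewrite ?mulr0.
Qed.

(* With [A], [B] the generating polynomials and [D = 1 - X + u X^m], the
   remainders [F = A D - 1] and [E = B D - 1] satisfy [A - B = B F - A E]. *)
Lemma renewal_compare (K : realFieldType) (m n : nat) (x u v w : K) (a b R : nat -> K) :
  (0 < m)%N -> (m < n)%N -> 0 <= w -> 0 <= x -> (forall j, 0 <= R j) ->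
  a 0%N = 1 -> b 0%N = 1 -> (forall k, 0 <= a k) -> (forall k, 0 <= b k) ->
  (forall k, (k.+1 < m)%N -> a k.+1 = a k /\ b k.+1 = b k) ->
  (forall i, (i + m <= n)%N ->
    a (i + m).-1 - u * a i + (if (0 < i)%N then v * a i.-1 else 0)
      - (if (m <= i)%N then w * a (i - m)%N else 0) <= a (i + m)%N) ->
  (forall i, (i + m <= n)%N ->
    b (i + m)%N <= b (i + m).-1 - u * b i
      + \sum_(2 <= j < m | (j <= i)%N) R j * b (i - j)%N) ->
  (forall k, (k < n)%N -> a k <= x * a k.+1) -> (forall k, (k <= n)%N -> 0 < a k) ->
  \sum_(2 <= j < m) R j * x ^+ j.-1 + w * x ^+ m.-1 < v ->
  b n < a n.
Proof.
move=> m0 mn w0 x0 R0 a0 b0 age0 bge0 small ha hb ratio agt0 num.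
(* Truncation at degree [n] loses nothing for the coefficient of [X^n], and all coefficients stay
   nonnegative. *)
pose A := \poly_(k < n.+1) a k; pose B := \poly_(k < n.+1) b k.
have AE k : (k <= n)%N -> A`_k = a k by move=> kn; rewrite coef_poly ltnS kn.
have BE k : (k <= n)%N -> B`_k = b k by move=> kn; rewrite coef_poly ltnS kn.
have A0 k : 0 <= A`_k by rewrite coef_poly; case: ifP.
have B0 k : 0 <= B`_k by rewrite coef_poly; case: ifP.
pose D : {poly K} := 1 - 'X + u *: 'X^m.
pose H : {poly K} := v *: 'X^(m.+1) - w *: 'X^(m + m).
pose S : {poly K} := \sum_(2 <= j < m) R j *: 'X^(m + j).
have coefMH (p : {poly K}) k : (p * H)`_k =
    (if (k < m.+1)%N then 0 else v * p`_(k - m.+1))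
    - (if (k < m + m)%N then 0 else w * p`_(k - (m + m))).
  rewrite mulrBr coefB -!scalerAr !coefZ !coefMXn.
  by do 2 case: ifP; rewrite ?mulr0.
have coefMS (p : {poly K}) k : (p * S)`_k =
    \sum_(2 <= j < m) (if (k < m + j)%N then 0 else R j * p`_(k - (m + j))).
  rewrite mulr_sumr coef_sum; apply: eq_bigr => j _.
  by rewrite -scalerAr coefZ coefMXn; case: ifP; rewrite ?mulr0.
have D0 (p : {poly K}) : (p * D)`_0 = p`_0.
  rewrite mulrDr mulrBr mulr1 coefD coefB coefMX /= -scalerAr coefZ coefMXn m0.
  by rewrite mulr0 addr0 subr0.
have DS (p : {poly K}) k : (p * D - 1)`_k.+1 = p`_k.+1 - p`_k
    + (if (k.+1 < m)%N then 0 else u * p`_(k.+1 - m)).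
  by rewrite coefB coef1 coefMDX subr0.
have hF k : (k <= n)%N -> (A * H)`_k <= (A * D - 1)`_k.
  move=> kn; rewrite coefMH; case: k kn => [|k] kn.
    by rewrite coefB coef1 D0 AE// a0 /= subrr addn_gt0 m0 subrr.
  rewrite DS (AE k.+1)// (AE k) ?(ltnW kn)//; case: (ltnP k.+1 m) => km.
    by rewrite (small _ km).1 subrr addr0 !ifT ?subrr//; lia.
  have := ha (k.+1 - m)%N; rewrite subnK// => /(_ kn) /=.
  rewrite AE; last by lia.
  have -> : (k.+1 < m.+1)%N = ~~ (0 < k.+1 - m)%N by lia.
  have -> : (k.+1 < m + m)%N = ~~ (m <= k.+1 - m)%N by lia.
  rewrite !if_neg.
  have -> : (k.+1 - m.+1 = (k.+1 - m).-1)%N by lia.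
  have -> : (k.+1 - (m + m) = (k.+1 - m) - m)%N by lia.
  rewrite !AE; try lia.
  by do 2 case: ifP => _; lra.
have hE k : (k <= n)%N -> (B * D - 1)`_k <= (B * S)`_k.
  move=> kn; rewrite coefMS; case: k kn => [|k] kn.
    rewrite coefB coef1 D0 BE// b0 /= subrr; apply: sumr_ge0 => j _.
    by case: ifP => // _; rewrite mulr_ge0.
  rewrite DS (BE k.+1)// (BE k) ?(ltnW kn)//; case: (ltnP k.+1 m) => km.
    rewrite (small _ km).2 subrr addr0; apply: sumr_ge0 => j _.
    by case: ifP => // _; rewrite mulr_ge0.
  have := hb (k.+1 - m)%N; rewrite subnK// => /(_ kn) /=.
  rewrite BE; last by lia.
  set s1 := \sum_(_ <= _ < _ | _) _; set s2 := \sum_(_ <= _ < _) _.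
  suff -> : s1 = s2 by lra.
  rewrite /s1 /s2 big_mkcond; apply: eq_bigr => j _.
  have -> : (k.+1 < m + j)%N = ~~ (j <= k.+1 - m)%N by lia.
  rewrite if_neg BE; last by lia.
  by have -> : (k.+1 - (m + j) = (k.+1 - m) - j)%N by lia.
(* Insert [F >= A H] and [E <= B S] into [A - B = B F - A E]. *)
have key : (A * B * H)`_n - (A * B * S)`_n <= a n - b n.
  rewrite -AE// -BE//.
  have -> : A`_n - B`_n = (B * (A * D - 1))`_n - (A * (B * D - 1))`_n.
    have AB : A - B = B * (A * D - 1) - A * (B * D - 1) by ring.
    by rewrite -coefB AB coefB.
  rewrite [A * B]mulrC -!mulrA [in X in _ - X]mulrCA.
  by apply: lerB; apply: le_coef_mulr.
pose C := A * B.
(* Drop the summand with [a 0] from the convolution of degree [k + 1] and compare the rest termwise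
   by the ratio bound on [a]. *)
have Cstep k : (k < n)%N -> C`_k <= x * C`_k.+1.
  move=> kn; rewrite !coefM [X in _ <= x * X]big_ord_recl mulrDr mulr_sumr.
  rewrite -[X in X <= _]add0r; apply: lerD.
    by rewrite mulr_ge0// mulr_ge0.
  apply: ler_sum => i _; rewrite mulrA; apply: ler_wpM2r => //.
  by have := ltn_ord i; rewrite lift0 => ik; rewrite !AE; [apply: ratio| |]; lia.
have C0 k : 0 <= C`_k by rewrite coefM; apply: sumr_ge0 => i _; rewrite mulr_ge0.
have Cd d k : (k + d <= n)%N -> C`_k <= x ^+ d * C`_(k + d).
  elim: d => [|d IH] kd; first by rewrite mul1r addn0.
  apply: le_trans (IH _) _; first by lia.
  rewrite exprSr -mulrA ler_wpM2l ?exprn_ge0// addnS; apply: Cstep; lia.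
(* The gain [v X^(m+1)] reads [C] at degree [N]; the losses read it at [N - (j - 1)] and
   [N - (m - 1)], or not at all, which costs a power of [x] relative to degree [N]. *)
set N := (n - m.+1)%N.
have CN : 0 < C`_N.
  rewrite coefM big_ord_recr /= subnn BE// b0 mulr1 AE; last by rewrite /N; lia.
  apply: ltr_wpDl; last by apply: agt0; rewrite /N; lia.
  by apply: sumr_ge0 => i _; rewrite mulr_ge0.
rewrite -subr_gt0; apply: lt_le_trans key.
rewrite coefMH coefMS -/C ifN; last by rewrite -leqNgt.
rewrite -/N -addrA -opprD.
rewrite -(ltr_pM2r CN) in num; rewrite subr_gt0; apply: le_lt_trans num.
rewrite addrC mulrDl mulr_suml; apply: lerD.
  apply: ler_sum_nat => j /andP[j2 jm]; case: ltnP => nj.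
    by rewrite mulr_ge0// mulr_ge0// exprn_ge0.
  rewrite -mulrA ler_wpM2l//.
  have -> : N = (n - (m + j) + j.-1)%N by rewrite /N; lia.
  by apply: Cd; lia.
case: ltnP => nj; first by rewrite mulr_ge0// mulr_ge0// exprn_ge0.
rewrite -mulrA ler_wpM2l//.
have -> : N = (n - (m + m) + m.-1)%N by rewrite /N; lia.
by apply: Cd; lia.
Qed.

(** Induction on [k]: the earlier ratios give [a (k - d) <= x^d a k], which bounds the losses by
    multiples of [a k]. Monotonicity of [a] merges [- u a i + v a (i - 1)] into at least
    [- (u - v) a i]. *)
Lemma renewal_ratio (K : realFieldType) (m n : nat) (x u v w : K) (a : nat -> K) :
  (0 < m)%N -> 0 <= v -> v <= u -> 0 <= w -> 1 <= x -> a 0%N = 1 ->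
  (forall k, (k < n)%N -> a k.+1 <= a k) ->
  (forall k, (k.+1 < m)%N -> a k.+1 = a k) ->
  (forall i, (i + m <= n)%N ->
    a (i + m).-1 - u * a i + (if (0 < i)%N then v * a i.-1 else 0)
      - (if (m <= i)%N then w * a (i - m)%N else 0) <= a (i + m)%N) ->
  1 <= x * (1 - u) ->
  1 <= x * (1 - (u - v) * x ^+ m.-1 - w * x ^+ (m + m).-1) ->
  forall k, (k <= n)%N -> 0 < a k /\ (forall l, (l < k)%N -> a l <= x * a l.+1).
Proof.
move=> m0 v0 vu w0 x1 a0 adec small ha hx1 hx2.
have x0 : 0 < x by apply: lt_le_trans x1.
have a1 k : (k < m)%N -> a k = 1.
  by elim: k => // k IH km; rewrite small// IH// ltnW.
elim=> [|k IH] kn; first by rewrite a0.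
have [ak0 rat] := IH (ltnW kn).
have back d : (d <= k)%N -> a (k - d)%N <= x ^+ d * a k.
  elim: d => [|d IHd] dk; first by rewrite subn0 mul1r.
  apply: le_trans (rat _ _) _; first by clear -dk; lia.
  have -> : (k - d.+1).+1 = (k - d)%N by clear -dk; lia.
  by rewrite exprS -mulrA ler_pM2l// IHd// ltnW.
suff step : a k <= x * a k.+1.
  split; first by rewrite -(pmulr_rgt0 _ x0) (lt_le_trans ak0).
  by move=> l; rewrite ltnS leq_eqVlt => /orP[/eqP->//|/rat].
have [km|mk] := ltnP k.+1 m; first by rewrite small// ler_peMl// ltW.
have := ha (k.+1 - m)%N; rewrite subnK// => /(_ kn) /=.
(* For [i = 0] the gain [v] is absent, but [a k = a 0 = 1], so the bound on [1 - u] suffices. *)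
set i := (k.+1 - m)%N; have [i0|i0] := posnP i.
  rewrite i0 a0 mulr1 addr0 ifN ?subr0; last by rewrite -ltnNge.
  rewrite a1; last by move: i0; rewrite /i; clear; lia.
  by move=> h; apply: le_trans hx1 _; rewrite ler_pM2l.
move=> h.
have h1 : a i <= a i.-1 by have := adec i.-1; rewrite prednK//; apply; clear -mk kn i0 m0; lia.
have h2 : a i <= x ^+ m.-1 * a k.
  have -> : i = (k - m.-1)%N by clear -mk m0; lia.
  by apply: back; clear -mk; lia.
have h3 : (if (m <= i)%N then w * a (i - m)%N else 0) <= w * x ^+ (m + m).-1 * a k.
  case: ifP => mi; last by rewrite !mulr_ge0// ?exprn_ge0 ?ltW.
  rewrite -mulrA ler_wpM2l//.
  have -> : (i - m = k - (m + m).-1)%N by clear -mi mk m0; lia.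
  by apply: back; clear -mi mk m0; lia.
have h4 : v * a i <= v * a i.-1 by rewrite ler_wpM2l.
have h5 : (u - v) * a i <= (u - v) * (x ^+ m.-1 * a k) by rewrite ler_wpM2l// subr_ge0.
have h6 : (1 - (u - v) * x ^+ m.-1 - w * x ^+ (m + m).-1) * a k <= a k.+1.
  apply: le_trans h.
  move: h3 h4 h5; set y := if _ then _ else _; lra.
apply: (@le_trans _ _ (x * ((1 - (u - v) * x ^+ m.-1 - w * x ^+ (m + m).-1) * a k))).
  by rewrite mulrA ler_peMl// ltW.
by rewrite ler_pM2l.
Qed.

(** * Central binomial coefficients and numerical estimates *)

Lemma central_bin_double j : ('C(2 * j.+1, j.+1) = 2 * 'C((2 * j).+1, j.+1))%N.
Proof.
have /= := mul_bin_diag (2 * j).+2 j; have -> : (2 * j).+2 = (2 * j.+1)%N by lia.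
have -> : 'C((2 * j).+1, j) = 'C((2 * j).+1, j.+1).
  by rewrite -bin_sub; [congr 'C(_, _); lia|lia].
by move=> e; apply/eqP; rewrite -(eqn_pmul2l (ltn0Sn j)) -e; apply/eqP; lia.
Qed.

Lemma central_bin_le4 j : ('C(2 * j.+1, j.+1) <= 4 * 'C(2 * j, j))%N.
Proof.
rewrite central_bin_double -[4%N]/(2 * 2)%N -mulnA leq_pmul2l//.
rewrite -(leq_pmul2l (ltn0Sn j)) -mul_bin_diag /= mulnA leq_mul2r; lia.
Qed.

Lemma central_bin_ge2 j : (0 < j)%N -> (2 <= 'C(2 * j, j))%N.
Proof. by case: j => // j _; rewrite central_bin_double leq_pmulr// bin_gt0; lia. Qed.

Section Numerics.
Variable K : realFieldType.

Definition inv_fact (n : nat) : K := (n`!%:R)^-1.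

Lemma inv_fact_gt0 n : 0 < inv_fact n.
Proof. by rewrite invr_gt0 ltr0n fact_gt0. Qed.

Lemma inv_fact_ge0 n : 0 <= inv_fact n. Proof. exact/ltW/inv_fact_gt0. Qed.

Lemma inv_factS n : inv_fact n.+1 = inv_fact n / n.+1%:R.
Proof. by rewrite /inv_fact factS natrM invfM mulrC. Qed.

Lemma inv_fact0 : inv_fact 0 = 1. Proof. by rewrite /inv_fact invr1. Qed.

Lemma inv_succ_le n p : (p <= n)%N -> (n.+1%:R)^-1 <= (p.+1%:R)^-1 :> K.
Proof. by move=> pn; rewrite lef_pV2 ?posrE ?ltr0n// ler_nat. Qed.

Lemma inv_fact_le n p : (p <= n)%N -> inv_fact n <= inv_fact p.
Proof.
move=> pn; rewrite lef_pV2 ?posrE ?ltr0n ?fact_gt0// ler_nat.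
exact: leq_fact.
Qed.

(** Upper bound for the probability that [m + j] letters form a cluster with shift [j]. *)
Definition cluster_wt m j : K := 'C(2 * j, j)%:R / 2 * inv_fact (m + j).

Lemma cluster_wt_ge0 m j : 0 <= cluster_wt m j.
Proof. by rewrite mulr_ge0 ?divr_ge0 ?inv_fact_ge0. Qed.

(** The binomial grows by a factor at most 4, the power by 10/9, and the factorial by
    [m + j + 1 >= 9]; and 40/81 < 1/2. *)
Lemma cluster_term_half m j (x : K) : 9%:R * x = 10%:R -> (5 <= m)%N -> (3 <= j)%N ->
  cluster_wt m j.+1 * x ^+ j <= cluster_wt m j * x ^+ j.-1 / 2.
Proof.
move=> xE m5; case: j => // j j3; have x0 : 0 <= x by lra.
rewrite /cluster_wt [(m + j.+2)%N]addnS inv_factS -pred_Sn exprS.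
have c4 : ('C(2 * j.+2, j.+2)%:R <= 4%:R * 'C(2 * j.+1, j.+1)%:R :> K).
  by rewrite -natrM ler_nat central_bin_le4.
have y9 : ((m + j.+1).+1%:R)^-1 <= (9%:R)^-1 :> K by apply: inv_succ_le; lia.
have Y0 : 0 <= ((m + j.+1).+1%:R)^-1 :> K by rewrite invr_ge0.
have P0 : 0 <= inv_fact (m + j.+1) * x ^+ j by rewrite mulr_ge0 ?exprn_ge0 ?inv_fact_ge0.
have C0 : 0 <= 'C(2 * j.+1, j.+1)%:R :> K by [].
have C0' : 0 <= 'C(2 * j.+2, j.+2)%:R :> K by [].
move: C0 C0' c4 y9 P0 Y0.
move: (_%:R) ('C(2 * j.+2, j.+2)%:R) (_^-1) (inv_fact _) (x ^+ j)
  => c c' y p q C0 C0' c4 y9 P0 Y0.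
have h : c' * y <= 4%:R * c * (9%:R)^-1 by apply: ler_pM.
have -> : c' / 2 * (p * y) * (x * q) = (c' * y * x) / 2 * (p * q) by ring.
have -> : c / 2 * p * q / 2 = (c / 4%:R) * (p * q) by field.
apply: ler_wpM2r => //.
have : c' * y * x <= 4%:R * c / 9%:R * x by rewrite ler_wpM2r.
have -> : 4%:R * c / 9%:R * x = 4%:R * c / 81%:R * (9%:R * x) by field.
rewrite xE; lra.
Qed.

Lemma cluster_sum_large m (x : K) : 9%:R * x = 10%:R -> (5 <= m)%N ->
  \sum_(2 <= j < m) cluster_wt m j * x ^+ j.-1 + inv_fact (m + m) * x ^+ m.-1 < inv_fact m.+1.
Proof.
move=> xE m5; pose T j := cluster_wt m j * x ^+ j.-1.
have x0 : 0 <= x by lra.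
have T0 j : 0 <= T j by rewrite mulr_ge0 ?cluster_wt_ge0 ?exprn_ge0.
have half j : (3 <= j)%N -> T j.+1 <= T j / 2 by exact: cluster_term_half.
(* The extra [T J] stands for the geometric tail and makes the induction go through. *)
have sumJ J : (3 <= J)%N -> \sum_(2 <= j < J.+1) T j + T J <= T 2 + 2 * T 3.
  elim: J => // J IH; rewrite leq_eqVlt => /orP[/eqP <-|J3].
    by rewrite big_nat_recr// big_nat1 /=; lra.
  by rewrite big_nat_recr /=; [have := IH J3; have := half _ J3; lra|lia].
have -> : \sum_(2 <= j < m) cluster_wt m j * x ^+ j.-1 = \sum_(2 <= j < m.+1) T j - T m.
  by rewrite big_nat_recr /= ?addrK//; lia.
have wT : inv_fact (m + m) * x ^+ m.-1 <= T m.
  rewrite /T /cluster_wt -[leRHS]mulrA ler_peMl//.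
    by rewrite mulr_ge0 ?exprn_ge0 ?inv_fact_ge0.
  by rewrite ler_pdivlMr// mul1r ler_nat central_bin_ge2//; lia.
have sm := sumJ m (leq_trans (isT : (3 <= 5)%N) m5).
(* In units of [1/(m+1)!] the left side is at most 10/21 + 2000/4536 < 1. *)
have big : T 2 + 2 * T 3 < inv_fact m.+1.
  rewrite /T /cluster_wt [(m + 2)%N]addn2 [(m + 3)%N]addn3.
  rewrite !(inv_factS m.+1) !(inv_factS m.+2) !(inv_factS m.+1).
  have -> : 'C(2 * 2, 2) = 6%N by [].
  have -> : 'C(2 * 3, 3) = 20%N by [].
  have y7 : (m.+2%:R)^-1 <= (7%:R)^-1 :> K by apply: inv_succ_le; lia.
  have y8 : (m.+3%:R)^-1 <= (8%:R)^-1 :> K by apply: inv_succ_le; lia.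
  have Y7 : 0 <= (m.+2%:R)^-1 :> K by rewrite invr_ge0.
  have Y8 : 0 <= (m.+3%:R)^-1 :> K by rewrite invr_ge0.
  have := ler_pM Y7 Y8 y7 y8; have := inv_fact_gt0 m.+1.
  move: y7; move: (inv_fact _) (m.+2%:R^-1) (m.+3%:R^-1) => p y z y7 p0 y78.
  have -> : x = 10%:R / 9%:R by lra.
  rewrite -[ltRHS]mulr1 -[(2.-1)%N]/1%N -[(3.-1)%N]/2%N.
  have -> : 6%:R / 2 * (p * y) * (10%:R / 9%:R) ^+ 1
      + 2 * (20%:R / 2 * (p * y * z) * (10%:R / 9%:R) ^+ 2)
    = p * (10%:R / 3%:R * y + 2000%:R / 81%:R * (y * z)) by field.
  by rewrite ltr_pM2l//; lra.
have := T0 m; lra.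
Qed.

Lemma inv_fact_pow_le M (x : K) : 9%:R * x = 10%:R -> (5 <= M)%N ->
  inv_fact M * x ^+ M.-1 <= 20%:R^-1.
Proof.
move=> xE; have x0 : 0 <= x by lra.
have xE' : x = 10%:R / 9%:R by lra.
elim: M => // M IH; rewrite leq_eqVlt => /orP[/eqP <-|M5].
  by rewrite !inv_factS inv_fact0 xE' -[(5.-1)%N]/4%N; lra.
apply: le_trans (IH M5); case: M M5 {IH} => // M M5.
rewrite inv_factS -!pred_Sn exprS.
have -> : inv_fact M.+1 / M.+2%:R * (x * x ^+ M)
  = (M.+2%:R^-1 * x) * (inv_fact M.+1 * x ^+ M) by ring.
rewrite ler_piMl//; first by rewrite mulr_ge0 ?inv_fact_ge0 ?exprn_ge0.
have y : M.+2%:R^-1 <= 2^-1 :> K by exact: inv_succ_le.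
by apply: (@le_trans _ _ (2^-1 * x)); [rewrite ler_wpM2r | lra].
Qed.

(** For [m = 3] the second bound forces [x >= 6/5], hence 4/3 in place of 10/9. The case [m = 4] is
    computed directly because the geometric estimate starts at [m = 5]. *)
Lemma numeric_bounds m : (2 < m)%N -> exists x : K, [/\ 1 <= x,
  1 <= x * (1 - inv_fact m),
  1 <= x * (1 - (inv_fact m - inv_fact m.+1) * x ^+ m.-1
            - inv_fact (m + m) * x ^+ (m + m).-1) &
  \sum_(2 <= j < m) cluster_wt m j * x ^+ j.-1 + inv_fact (m + m) * x ^+ m.-1 < inv_fact m.+1].
Proof.
move=> m3; have [m5|m4] := leqP 5 m.
  pose x : K := 10%:R / 9%:R; have xE : 9%:R * x = 10%:R by rewrite /x; field.
  exists x; split; [by lra| | |exact: cluster_sum_large].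
    have : inv_fact m <= inv_fact 5 by exact: inv_fact_le.
    by rewrite !inv_factS inv_fact0 /x; lra.
  have h1 := inv_fact_pow_le xE m5.
  have h2 : inv_fact (m + m) * x ^+ (m + m).-1 <= 20%:R^-1.
    by apply: inv_fact_pow_le => //; lia.
  have h3 : 0 <= inv_fact m.+1 * x ^+ m.-1.
    by rewrite mulr_ge0 ?inv_fact_ge0// exprn_ge0//; lra.
  rewrite mulrBl; move: h1 h2 h3.
  move: (inv_fact m * _) (inv_fact (m + m) * _) (inv_fact m.+1 * _) => p q r h1 h2 h3.
  by rewrite /x; lra.
have [->|->] : m = 3%N \/ m = 4%N by lia.
  exists (4%:R / 3%:R); rewrite big_nat1 /cluster_wt -['C(2 * 2, 2)]/6%N.
  rewrite -[(3 + 2)%N]/5%N -[(3 + 3)%N]/6%N !inv_factS inv_fact0.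
  rewrite -[(3.-1)%N]/2%N -[(2.-1)%N]/1%N -[(6.-1)%N]/5%N.
  by split; lra.
exists (10%:R / 9%:R); rewrite big_ltn// big_nat1 /cluster_wt.
have -> : 'C(2 * 2, 2) = 6%N by [].
have -> : 'C(2 * 3, 3) = 20%N by [].
rewrite -[(4 + 2)%N]/6%N -[(4 + 3)%N]/7%N -[(4 + 4)%N]/8%N !inv_factS inv_fact0.
rewrite -[(4.-1)%N]/3%N -[(2.-1)%N]/1%N -[(3.-1)%N]/2%N -[(8.-1)%N]/7%N.
by split; lra.
Qed.

End Numerics.

End Renewal.

(** * Comparison of the frequencies *)

Section Frequencies.
Local Open Scope ring_scope.

Definition freq n (P : pred 'S_n) : rat := #|[set p | P p]|%:R * inv_fact _ n.

Lemma freq_ge0 n (P : pred 'S_n) : 0 <= freq P.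
Proof. by rewrite mulr_ge0 ?inv_fact_ge0. Qed.

Lemma le_freq n (P Q : pred 'S_n) : (forall p, P p -> Q p) -> freq P <= freq Q.
Proof.
move=> PQ; rewrite ler_wpM2r ?inv_fact_ge0// ler_nat subset_leq_card//.
by apply/subsetP => p; rewrite !inE; apply: PQ.
Qed.

Lemma freq1 n (P : pred 'S_n) : (forall p, P p) -> freq P = 1.
Proof.
move=> PT; rewrite /freq (_ : [set p | P p] = setT).
  by rewrite cardsT card_Sn mulfV// pnatr_eq0 -lt0n fact_gt0.
by apply/setP => p; rewrite !inE PT.
Qed.

Lemma freq_window n i L (r : 'S_L) (Q : pred 'S_n) :
  (i + L <= n)%N -> prefix_event i Q ->
  freq (fun p => Q p && occ r (letter p) i) = inv_fact _ L * freq Q.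
Proof.
move=> iL QP; rewrite /freq -(card_window r iL QP) natrM [RHS]mulrA; congr (_ * _).
by rewrite mulrCA mulVf ?mulr1// pnatr_eq0 -lt0n fact_gt0.
Qed.

(** The [m + j] letters from [i] have exactly one pattern, and both occurrences are present exactly
    when it is a cluster; so [freq_window] is summed over the clusters. *)
Lemma freq_clusters n i m (s : 'S_m) j (Q : pred 'S_n) :
  (i + (m + j) <= n)%N -> prefix_event i Q ->
  freq (fun p => Q p && (occ s (letter p) i && occ s (letter p) (i + j)))
  = #|clusters s j|%:R * inv_fact _ (m + j) * freq Q.
Proof.
move=> iL QP; rewrite -mulrA mulr_natl -sumr_const.
rewrite (eq_bigr (fun r : 'S_(m + j) =>
  freq (fun p => Q p && occ r (letter p) i))); last first.
  by move=> r _; rewrite freq_window.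
rewrite /freq -mulr_suml -natr_sum; congr (_%:R * _).
rewrite card_set_sum; under [RHS]eq_bigr do rewrite card_set_sum.
rewrite exchange_big; apply: eq_bigr => p _.
have [r0 r0P] := occ_exists p iL.
have shift k : (k + m <= m + j)%N -> occ s (letter p) (i + k) = occ s (letter r0) k.
  move=> kL; apply/occP/occP => h x y; have := h x y;
  move/occ_letterP: r0P => /(_ (k + x)%N (k + y)%N);
  by rewrite !addnA => -> //; apply: leq_trans kL; rewrite ltn_add2l.
rewrite -{1}[i]addn0 !shift; [|by rewrite addnC|by rewrite leq_addr].
case: (boolP (Q p)) => /= Qp; last by rewrite big1.
case: (boolP (r0 \in clusters s j)) => r0C.
  rewrite (bigD1 r0)//= big1 ?addn0; last first.
    move=> r /andP[_ ne]; case: (boolP (occ r _ _)) => // /(occ_uniq r0P) e.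
    by rewrite e eqxx in ne.
  by rewrite r0P; move: r0C; rewrite inE => ->.
rewrite big1; last first.
  move=> r rC; case: (boolP (occ r _ _)) => // /(occ_uniq r0P) e.
  by rewrite e rC in r0C.
by move: r0C; rewrite inE => /negbTE ->.
Qed.

Lemma freq_step_le n m (s : 'S_m) i : s <> incr_perm m -> s <> decr_perm m ->
  (i + m <= n)%N ->
  freq (@prefix_avoids _ s n (i + m)) <= freq (@prefix_avoids _ s n (i + m).-1)
    - inv_fact _ m * freq (@prefix_avoids _ s n i)
    + \sum_(2 <= j < m | (j <= i)%N) cluster_wt _ m j * freq (@prefix_avoids _ s n (i - j)).
Proof.
move=> s1 s2 im; have m2 := nonmonotone_size s1 s2.
rewrite -(freq_window s im (@prefix_avoids_event _ s n i)).
have := @prefix_avoids_step_le n m s i (ltnW (ltnW m2)).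
rewrite big_ltn_cond; last by lia.
(* The term at distance 1 vanishes, since [s] is not monotone. *)
rewrite (_ : (if _ then _ else _) = \sum_(2 <= j < m | j <= i)
  #|[set p : 'S_n | prefix_avoids s (i - j) p &&
     (occ s (letter p) (i - j) && occ s (letter p) i)]|)%N; last first.
  case: ifP => // i1; rewrite (_ : #|_| = 0)%N//; apply/eqP.
  rewrite cards_eq0; apply/eqP/setP => p; rewrite !inE; apply/negP => /andP[_ /andP[o1]].
  have -> : i = (i - 1).+1 by lia.
  by move=> o2; have [] := occ_succ_monotone o1 o2.
rewrite -(ler_nat rat) !natrD => h.
have {h} := ler_wpM2r (inv_fact_ge0 _ n) h; rewrite !mulrDl natr_sum mulr_suml => h.
suff le : \sum_(2 <= j < m | (j <= i)%N)
    #|[set p : 'S_n | prefix_avoids s (i - j) p &&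
     (occ s (letter p) (i - j) && occ s (letter p) i)]|%:R * inv_fact rat n
    <= \sum_(2 <= j < m | (j <= i)%N) cluster_wt rat m j * freq (@prefix_avoids _ s n (i - j)).
  have arith (y1 y2 y3 y4 y5 : rat) : y1 + y2 <= y3 + y4 -> y4 <= y5 -> y1 <= y3 - y2 + y5.
    by lra.
  exact: arith h le.
rewrite big_nat_cond [leRHS]big_nat_cond.
apply: ler_sum => j /andP[/andP[j2 jm] ji].
have jL : (i - j + (m + j) <= n)%N by lia.
have := freq_clusters s jL (@prefix_avoids_event _ s n (i - j)); rewrite subnK// => eqf.
rewrite /freq in eqf; rewrite eqf; apply: ler_wpM2r; first exact: freq_ge0.
apply: ler_wpM2r; first exact: inv_fact_ge0.
rewrite ler_pdivlMr// -natrM ler_nat mulnC card_clusters//; lia.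
Qed.

Lemma freq_incr_step_ge n m i : (1 < m)%N -> (i + m <= n)%N ->
  freq (@prefix_avoids _ (incr_perm m) n (i + m).-1)
    - inv_fact _ m * freq (@prefix_avoids _ (incr_perm m) n i)
    + (if (0 < i)%N then inv_fact _ m.+1 * freq (@prefix_avoids _ (incr_perm m) n i.-1) else 0)
    - (if (m <= i)%N
       then inv_fact _ (m + m) * freq (@prefix_avoids _ (incr_perm m) n (i - m)) else 0)
  <= freq (@prefix_avoids _ (incr_perm m) n (i + m)).
Proof.
move=> m1 im.
have := @incr_step_ge n m i m1; rewrite -(ler_nat rat) !natrD !natrM => h.
have {h} := ler_wpM2r (inv_fact_ge0 _ n) h; rewrite !mulrDl -!mulrA.
have e1 := freq_window (incr_perm m) im (@prefix_avoids_event _ (incr_perm m) n i).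
have e2 : (0 < i)%N -> _ := fun i0 => @freq_window n i.-1 m.+1 (incr_perm m.+1) _ _
  (@prefix_avoids_event _ (incr_perm m) n i.-1).
have e3 : (m <= i)%N -> _ := fun i0 => @freq_window n (i - m) (m + m) (incr_perm (m + m)) _ _
  (@prefix_avoids_event _ (incr_perm m) n (i - m)).
rewrite -e1; case: posnP => [i0|i0].
  case: leqP => im0; first by lia.
  rewrite !mul0r /freq; lra.
rewrite -e2//; last by lia.
case: leqP => im0; first by rewrite -e3 ?mul1r /freq; [lra|lia|lia].
rewrite !mul0r mul1r /freq; lra.
Qed.

End Frequencies.

Theorem theorem2p10 (m : nat) (hm : 2 <= m) (sigma : 'S_m)
    (hincr : sigma <> incr_perm m) (hdecr : sigma <> decr_perm m) :
  exists n0 : nat, forall n : nat, n0 <= n ->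
    alpha n sigma < alpha n (incr_perm m).
Proof.
have m3 := nonmonotone_size hincr hdecr.
have m0 : 0 < m by apply: ltn_trans m3.
(* At [n = m] each pattern excludes one permutation and the counts agree; from [m + 1] on the gain
   of degree [m + 1] reaches the coefficient of [X^n]. *)
exists m.+1 => n mn.
have alphaE (s : 'S_m) : alpha n s = #|[set p : 'S_n | prefix_avoids s n p]|.
  by congr #|pred_of_set _|; apply/setP => p; rewrite !inE avoids_prefix_avoids.
rewrite !alphaE -(ltr_nat rat) -(ltr_pM2r (inv_fact_gt0 rat n)).
have [x [x1 hx1 hx2 num]] := @numeric_bounds rat m m3.
have av_small (s : 'S_m) k : (k < m)%N -> freq (@prefix_avoids _ s n k) = 1%R.
  by move=> km; apply: freq1 => p; apply/prefix_avoidsP => i; lia.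
pose a k := freq (@prefix_avoids _ (incr_perm m) n k).
pose b k := freq (@prefix_avoids _ sigma n k).
have ha i : (i + m <= n)%N -> _ := @freq_incr_step_ge n m i hm.
have hb i : (i + m <= n)%N -> _ := @freq_step_le n m sigma i hincr hdecr.
have [v0 w0] : (0 <= inv_fact rat m.+1 /\ 0 <= inv_fact rat (m + m))%R.
  by split; exact: inv_fact_ge0.
have vu : (inv_fact rat m.+1 <= inv_fact rat m)%R by exact: inv_fact_le.
have adec k : (k < n)%N -> (a k.+1 <= a k)%R.
  by move=> _; apply: le_freq => p; apply: prefix_avoids_leq.
have asmall k : (k.+1 < m)%N -> a k.+1 = a k.
  by move=> km; rewrite /a !av_small// ltnW.
have rat_a := renewal_ratio m0 v0 vu w0 x1 (av_small _ _ m0) adec asmall ha hx1 hx2.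
apply: (@renewal_compare _ m n x (inv_fact rat m) (inv_fact rat m.+1)
  (inv_fact rat (m + m)) a b
  (cluster_wt rat m)) => //.
- by apply: le_trans x1.
- exact: cluster_wt_ge0.
- exact: av_small.
- exact: av_small.
- by move=> k; apply: freq_ge0.
- by move=> k; apply: freq_ge0.
- by move=> k km; rewrite /a /b !av_small// ltnW.
- by move=> k kn; apply: (rat_a n (leqnn _)).2.
- by move=> k kn; case: (rat_a k kn).
Qed.
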